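(* Fix integers $k,\ell\geq 0$, an integer $N\ge1$, real coefficients $K_1,\dots,K_N$, and finite edge sets $E^1,\dots,E^N$ of the form described in the context. Then the following are equivalent: (1) for every $v\in\mathrm{GF}(2)^{(k+1)(\ell+1)}$, $\sum_{i=1}^N K_i\,A_{k,\ell,E^i}(v)=0$; (2) for every marked permutation $\sigma$ (with $k$ bottom marks and $\ell$ top marks), $\sum_{i=1}^N K_i\,A(\sigma_{k,\ell,E^i})=0$. The same equivalence holds with $A_{k,\ell,E^i}$ and $A$ replaced by $\bar A_{k,\ell,E^i}$ and $\bar A$ respectively.
   Context: For a permutation $\tau$ of size $m\geq 0$ with edge set $E(\tau)=\{(i,\tau(i))\}$ (drawn as a diagram with $m$ bottom and $m$ top points, left to right), and $I\subseteq E(\tau)$, let $\chi_I$ be the number of pairs of non-crossing edges in $I$ (edges $(i,\tau(i)),(j,\tau(j))$ with $i<j$ are non-crossing iff $\tau(i)<\tau(j)$). Define $A(\tau)=\sum_{I\subseteq E(\tau)}(-1)^{\chi_I}$ and $\bar A(\tau)=\sum_{I\subseteq E(\tau)}(-1)^{|I|+\chi_I}$. A marked permutation (with $k$ bottom and $\ell$ top marks) is a permutation $\sigma$ of any size $\geq 0$ together with a decomposition of its bottom points, read left to right, into $k+1$ consecutive (possibly empty) intervals $P_{-,1},\dots,P_{-,k+1}$, and of its top points into $\ell+1$ consecutive (possibly empty) intervals $P_{+,1},\dots,P_{+,\ell+1}$; bottom mark $a$ ($1\le a\le k$) sits between $P_{-,a}$ and $P_{-,a+1}$, bottom mark $0$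 is the left corner and bottom mark $k+1$ the right corner; similarly top marks $0,\dots,\ell+1$. An edge set $E'$ is a finite set of new edges $e=(a.x,\,b.y)$ with $0\le a\le k+1$, $0\le b\le \ell+1$, meaning $e$ has its bottom endpoint at bottom mark $a$, being the $x$-th among the new bottom endpoints at that mark (left to right), and its top endpoint at top mark $b$, being the $y$-th among the new top endpoints at that mark; for each mark the positions used are exactly $1,2,\dots$ up to the number of new endpoints there. The permutation $\sigma_{k,\ell,E'}$ is obtained from the marked permutation $\sigma$ by inserting, at each bottom (resp. top) mark, the new bottom (resp. top) endpoints in the prescribed order, and adding the edges of $E'$; it is the permutation of size $|E(\sigma)|+|E'|$ so obtained. For $e=(a.x,b.y)\in E'$ and $1\le i\le k+1$, $1\le j\le \ell+1$, let $Q_{e,ij}\in\mathrm{GF}(2)$ equal $1$ if $e$ does not cross a segment joining a point of $P_{-,i}$ to a point of $P_{+,j}$ (equivalently, $[a<i]=[b<j]$), and $0$ otherwise. For $u\in\mathrm{GF}(2)^{E'}$ (identified with a subset of $E'$) let $|u|$ be its number of ones and $\chi_u$ the number of non-crossing pairs of edges of $E'$ in $u$ (crossing determined by their relative order in $\sigma_{k,\ell,E'}$). For $v\in\mathrm{GF}(2)^{(k+1)(\ell+1)}$ (indexed by pairs $ij$), define $A_{k,\ell,E'}(v)=\sum_{u\in\mathrm{GF}(2)^{E'}}(-1)^{\chi_u+(u,Qv)}$ and $\bar A_{k,\ell,E'}(v)=\sum_{u\in\mathrm{GF}(2)^{E'}}(-1)^{|u|+\chi_u+(u,Qv)}$, where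 $(u,Qv)=\sum_{e,ij}u_eQ_{e,ij}v_{ij}\in\mathrm{GF}(2)$. *)

(* Defs.v *)
From HB Require Import structures.
From mathcomp Require Import all_boot all_order all_algebra all_fingroup.
From mathcomp Require Import finmap reals.

Set Implicit Arguments.
Unset Strict Implicit.
Unset Printing Implicit Defensive.

Import GRing.Theory.
Local Open Scope ring_scope.

Section Permutations.
Variable m : nat.
Implicit Types (t : 'S_m) (I : {set 'I_m * 'I_m}).

Definition perm_edges t : {set 'I_m * 'I_m} := [set (i, t i) | i : 'I_m].

(* Each unordered pair is counted once, its first edge being the one with the
   leftmost bottom endpoint. *)
Definition noncrossing_pairs I : nat :=
  #|[set p in setX I I | (p.1.1 < p.2.1)%N && (p.1.2 < p.2.2)%N]|.

Definition A_perm t : int :=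
  \sum_(I : {set 'I_m * 'I_m} | I \subset perm_edges t)
     (-1) ^+ noncrossing_pairs I.

Definition Abar_perm t : int :=
  \sum_(I : {set 'I_m * 'I_m} | I \subset perm_edges t)
     (-1) ^+ (#|I| + noncrossing_pairs I).

End Permutations.

(* A decomposition of m points into k+1 consecutive, possibly empty, intervals
   is a nondecreasing map 'I_m -> 'I_k.+1 sending a point to the (0-based) index
   of its interval: P_{-,i} is the fibre of mp_bot over i - 1, and P_{+,j} the
   fibre of mp_top over j - 1. *)
Record marked_perm (k l : nat) := MarkedPerm {
  mp_size : nat;
  mp_perm : 'S_mp_size;
  mp_bot : 'I_mp_size -> 'I_k.+1;
  mp_top : 'I_mp_size -> 'I_l.+1;
  mp_bot_mono : forall i j : 'I_mp_size, (i <= j)%N -> (mp_bot i <= mp_bot j)%N;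
  mp_top_mono : forall i j : 'I_mp_size, (i <= j)%N -> (mp_top i <= mp_top j)%N
}.

Arguments mp_bot {k l}.
Arguments mp_top {k l}.

(* The edge (a.x, b.y) is the tuple ((a, x), (b, y)). *)
Notation new_edge k l := (('I_k.+2 * nat) * ('I_l.+2 * nat))%type.

Record edge_set (k l : nat) := EdgeSet {
  es_fset :> {fset new_edge k l};
  es_bot : forall a : 'I_k.+2,
    perm_eq [seq e.1.2 | e <- es_fset & e.1.1 == a]
            (iota 1 (count (fun e => e.1.1 == a) es_fset));
  es_top : forall b : 'I_l.+2,
    perm_eq [seq e.2.2 | e <- es_fset & e.2.1 == b]
            (iota 1 (count (fun e => e.2.1 == b) es_fset))
}.

(* Endpoints on one side are located by a pair (slot, rank in slot), compared
   lexicographically.  Mark a is slot 2a and the interval of 0-based index i is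
   slot 2i+1, so that the slots read left to right are: left corner, first
   interval, mark 1, second interval, ..., last interval, right corner. *)
Definition lex_lt (p q : nat * nat) : bool :=
  (p.1 < q.1)%N || ((p.1 == q.1) && (p.2 < q.2)%N).

Definition lex_le (p q : nat * nat) : bool :=
  (p.1 < q.1)%N || ((p.1 == q.1) && (p.2 <= q.2)%N).

Definition new_bot_loc k l (e : new_edge k l) : nat * nat := (e.1.1.*2, e.1.2).
Definition new_top_loc k l (e : new_edge k l) : nat * nat := (e.2.1.*2, e.2.2).

Section Insertion.
Variables (k l : nat) (s : marked_perm k l) (E : edge_set k l).

(* The edges of sigma_{k,l,E'}; an old edge (i, sigma(i)) is represented by i. *)
Definition all_edges : finType := ('I_(mp_size s) + E)%type.

Lemma card_all_edges : #|all_edges| = (mp_size s + #|` E|)%N.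
Proof. by rewrite card_sum card_ord -cardfE. Qed.

Definition bot_loc (f : all_edges) : nat * nat :=
  match f with
  | inl i => ((mp_bot s i).*2.+1, nat_of_ord i)
  | inr e => new_bot_loc (val e)
  end.

Definition top_loc (f : all_edges) : nat * nat :=
  match f with
  | inl i => ((mp_top s (mp_perm s i)).*2.+1, nat_of_ord (mp_perm s i))
  | inr e => new_top_loc (val e)
  end.

(* All edges, listed in the left-to-right order of their bottom (resp. top)
   endpoints. *)
Definition bot_list : #|all_edges|.-tuple all_edges :=
  [tuple of sort (relpre bot_loc lex_le) (enum_tuple all_edges)].
Definition top_list : #|all_edges|.-tuple all_edges :=
  [tuple of sort (relpre top_loc lex_le) (enum_tuple all_edges)].

Lemma mem_top_list f : f \in top_list.
Proof. by rewrite mem_sort mem_enum. Qed.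

Lemma top_pos_subproof f : (index f top_list < #|all_edges|)%N.
Proof. by rewrite -{2}(size_tuple top_list) index_mem mem_top_list. Qed.

Definition top_pos (f : all_edges) : 'I_#|all_edges| := Ordinal (top_pos_subproof f).

Lemma insert_fun_inj : injective (fun p => top_pos (tnth bot_list p)).
Proof.
move=> p q /(congr1 val) /= /(congr1 (nth (tnth bot_list p) top_list)).
rewrite !nth_index ?mem_top_list //; apply/tuple_uniqP.
by rewrite sort_uniq enum_uniq.
Qed.

(* The permutation sigma_{k,l,E'}: the bottom point p is the bottom endpoint of
   the p-th edge of bot_list, and is sent to the top endpoint of this edge. *)
Definition insert_edges : 'S_#|all_edges| := perm insert_fun_inj.

End Insertion.

Section MarkedSums.
Variables (k l : nat) (E : edge_set k l).
Implicit Types (u : {ffun E -> 'F_2}) (v : {ffun 'I_k.+1 * 'I_l.+1 -> 'F_2}).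

(* The 0-based pair ij stands for the pair (ij.1 + 1, ij.2 + 1). *)
Definition Qmx (e : E) (ij : 'I_k.+1 * 'I_l.+1) : 'F_2 :=
  (((val e).1.1 < ij.1.+1)%N == ((val e).2.1 < ij.2.+1)%N)%:R.

Definition pairing u v : 'F_2 := \sum_(e : E) \sum_ij u e * Qmx e ij * v ij.

Definition weight u : nat := #|[set e | u e == 1]|.

Definition new_noncrossing_pairs u : nat :=
  #|[set p : E * E | [&& u p.1 == 1, u p.2 == 1,
       lex_lt (new_bot_loc (val p.1)) (new_bot_loc (val p.2))
     & lex_lt (new_top_loc (val p.1)) (new_top_loc (val p.2))]]|.

(* An element of 'F_2 in an exponent is read as its representative 0 or 1. *)
Definition A_marked v : int :=
  \sum_(u : {ffun E -> 'F_2})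
     (-1) ^+ (new_noncrossing_pairs u + nat_of_ord (pairing u v)).

Definition Abar_marked v : int :=
  \sum_(u : {ffun E -> 'F_2})
     (-1) ^+ (weight u + new_noncrossing_pairs u + nat_of_ord (pairing u v)).

End MarkedSums.

(* Main.v *)
(** Split a set of edges of sigma_{k,l,E'} into a set I of old edges and a set u
    of new ones.  The number of non-crossing pairs between I and u is, modulo 2,
    (u, Q v_I), where v_I records the parity of the number of edges of I in each
    cell P_{-,i} x P_{+,j}; hence A(sigma_{k,l,E'}) is the sum over I of
    (-1)^{chi_I} A_{k,l,E'}(v_I), and (1) implies (2).

    Conversely, given v, take sigma with exactly one edge in each cell of the
    support of v.  Then v_I = v for the full edge set I, while v_I has smaller
    support for every other I, so (1) follows from (2) by induction on the size of
    the support. *)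

Require Import Defs.
From HB Require Import structures.
From mathcomp Require Import all_boot all_order all_algebra all_fingroup.
From mathcomp Require Import finmap reals.

Import GRing.Theory.
Local Open Scope ring_scope.

(** * Lexicographic order on endpoint locations *)

Lemma lex_le_total : total lex_le.
Proof.
move=> [a x] [b y]; rewrite /lex_le /=.
by case: (ltngtP a b) => //= _; exact: leq_total.
Qed.

Lemma lex_le_trans : transitive lex_le.
Proof.
move=> [b y] [a x] [c z]; rewrite /lex_le /=.
case/orP=> [ab|/andP[/eqP-> xy]]; case/orP=> [bc|/andP[/eqP<- yz]].
- by rewrite (ltn_trans ab bc).
- by rewrite ab.
- by rewrite bc.
- by rewrite eqxx (leq_trans xy yz) orbT.
Qed.

Lemma lex_ltNge p q : lex_lt p q = ~~ lex_le q p.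
Proof.
case: p q => [a x] [b y]; rewrite /lex_lt /lex_le /= negb_or negb_and.
by case: (ltngtP a b) => //= _; rewrite -ltnNge.
Qed.

Lemma lex_le_anti p q : lex_le p q -> lex_le q p -> p = q.
Proof.
case: p q => [a x] [b y]; rewrite /lex_le /=.
by case: (ltngtP a b) => //= -> xy yx; congr (_, _); apply/eqP; rewrite eqn_leq xy.
Qed.

Lemma lex_ltxx p : lex_lt p p = false.
Proof. by rewrite /lex_lt eqxx !ltnn. Qed.

(** Injectivity of [loc] excludes ties, so the position in the sorted list reflects the strict order
    of locations. *)
Lemma ltn_index_sort_lex (T : eqType) (loc : T -> nat * nat) (r : seq T) f g :
    injective loc -> f \in r -> g \in r ->
  (index f (sort (relpre loc lex_le) r) < index g (sort (relpre loc lex_le) r))%N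
    = lex_lt (loc f) (loc g).
Proof.
move=> loc_inj fr gr; set s := sort _ r.
have tr : transitive (relpre loc lex_le) by move=> y x z; exact: lex_le_trans.
have srt : sorted (relpre loc lex_le) s.
  by apply: sort_sorted => x y; exact: lex_le_total.
have fs : f \in s by rewrite mem_sort.
have gs : g \in s by rewrite mem_sort.
have lt_le := sorted_ltn_index tr srt.
rewrite lex_ltNge; case: ltngtP => [lt|lt|eq].
- apply/esym/negP => le_gf.
  have /loc_inj fg : loc f = loc g.
    by apply: lex_le_anti le_gf; exact: (lt_le _ _ fs gs lt).
  by move: lt; rewrite fg ltnn.
- by rewrite [lex_le _ _](lt_le _ _ gs fs lt).
- have -> : f = g by rewrite -(nth_index f fs) eq nth_index.
  by rewrite -lex_ltNge lex_ltxx.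
Qed.

(** By monotonicity the interval index never contradicts the order of the points. *)
Lemma lex_lt_interval m n (f : 'I_m -> 'I_n) :
    (forall i j : 'I_m, (i <= j)%N -> (f i <= f j)%N) ->
  forall i j : 'I_m,
    lex_lt ((f i).*2.+1, nat_of_ord i) ((f j).*2.+1, nat_of_ord j) = (i < j)%N.
Proof.
move=> f_mono i j; rewrite /lex_lt /= ltnS ltn_double eqSS (inj_eq double_inj).
by case: (ltnP i j) => ij; [have := f_mono _ _ (ltnW ij) | have := f_mono _ _ ij];
   case: ltngtP.
Qed.

(** * Signs indexed by GF(2) *)

(** The nontrivial character of GF(2); it turns the sum defining [pairing] into a product of
    signs. *)
Definition signF2 (x : 'F_2) : int := (-1) ^+ nat_of_ord x.

Lemma signF2D : {morph signF2 : x y / x + y >-> x * y}.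
Proof. by case=> [[|[|[]]] ? //] [[|[|[]]] ? //]; apply/eqP. Qed.

Lemma signF20 : signF2 0 = 1.
Proof. by []. Qed.

Lemma signF2_nat (b : bool) : signF2 b%:R = (-1) ^+ b.
Proof. by case: b. Qed.

Lemma F2_natE (x : 'F_2) : x = (x == 1)%:R.
Proof. by case: x => [[|[|[]]] ? //]; apply/eqP. Qed.

Lemma sign_card (T : finType) (A : {pred T}) :
  (-1) ^+ #|A| = \prod_x (-1) ^+ (x \in A) :> int.
Proof.
by rewrite -prodr_const big_mkcond; apply: eq_bigr => x _; case: (x \in A).
Qed.

Lemma uniq_map_inj_in (T1 T2 : eqType) (f : T1 -> T2) (r : seq T1) :
  uniq (map f r) -> {in r &, injective f}.
Proof.
move=> Ur x y xr yr fxy; rewrite -(nth_index x xr) -[RHS](nth_index x yr).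
congr (nth x r _); apply/eqP.
rewrite -(nth_uniq (f x) _ _ Ur) ?size_map ?index_mem //.
by rewrite !(nth_map x) ?index_mem // !nth_index // fxy.
Qed.

(* The two cases of the theorem are treated at once: b = false gives A, and
   b = true gives \bar A. *)
Definition signed_A_perm (b : bool) {m} (t : 'S_m) : int :=
  \sum_(I : {set 'I_m * 'I_m} | I \subset perm_edges t)
     (-1) ^+ (b * #|I| + noncrossing_pairs I).

Definition signed_A_marked (b : bool) {k l} (E : edge_set k l)
    (v : {ffun 'I_k.+1 * 'I_l.+1 -> 'F_2}) : int :=
  \sum_(u : {ffun E -> 'F_2})
     (-1) ^+ (b * weight u + new_noncrossing_pairs u + nat_of_ord (pairing u v)).

(** * Expansion of the signed sum of the enlarged permutation over sets of old edges *)

Section Expansion.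
Context {k l : nat} (s : marked_perm k l) (E : edge_set k l).
Let T : finType := all_edges s E.

(** The ranks used at one mark are a permutation of an [iota], hence pairwise distinct. *)
Lemma new_bot_loc_inj : injective (fun e : E => new_bot_loc (val e)).
Proof.
move=> e f [/double_inj/val_inj eq1 eq2]; apply: val_inj.
have := es_bot E (val e).1.1 => /perm_uniq; rewrite iota_uniq.
by move/uniq_map_inj_in; apply=> //; rewrite mem_filter ?eqxx ?eq1 ?eqxx fsvalP.
Qed.

Lemma new_top_loc_inj : injective (fun e : E => new_top_loc (val e)).
Proof.
move=> e f [/double_inj/val_inj eq1 eq2]; apply: val_inj.
have := es_top E (val e).2.1 => /perm_uniq; rewrite iota_uniq.
by move/uniq_map_inj_in; apply=> //; rewrite mem_filter ?eqxx ?eq1 ?eqxx fsvalP.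
Qed.

(** Old slots are odd and new slots even, so an old and a new edge never share a location. *)
Lemma bot_loc_inj : injective (@bot_loc k l s E).
Proof.
move=> [i|e] [j|f] //=.
- by case=> _ /val_inj->.
- by case=> /(congr1 odd); rewrite /= !odd_double.
- by case=> /(congr1 odd); rewrite /= !odd_double.
- by move/new_bot_loc_inj->.
Qed.

Lemma top_loc_inj : injective (@top_loc k l s E).
Proof.
move=> [i|e] [j|f] //=.
- by case=> _ /val_inj/perm_inj->.
- by case=> /(congr1 odd); rewrite /= !odd_double.
- by case=> /(congr1 odd); rewrite /= !odd_double.
- by move/new_top_loc_inj->.
Qed.

Lemma mem_bot_list (f : T) : f \in bot_list s E.
Proof. by rewrite mem_sort mem_enum. Qed.

Lemma bot_pos_subproof (f : T) : (index f (bot_list s E) < #|T|)%N.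
Proof. by rewrite -{2}(size_tuple (bot_list s E)) index_mem mem_bot_list. Qed.

Definition bot_pos (f : T) : 'I_#|T| := Ordinal (bot_pos_subproof f).

Definition edge_pos (f : T) : 'I_#|T| * 'I_#|T| := (bot_pos f, top_pos f).

Lemma tnth_bot_pos f : tnth (bot_list s E) (bot_pos f) = f.
Proof. by rewrite (tnth_nth f) nth_index ?mem_bot_list. Qed.

Lemma bot_pos_tnth p : bot_pos (tnth (bot_list s E) p) = p.
Proof.
apply: val_inj => /=; rewrite (tnth_nth (tnth (bot_list s E) p)).
by rewrite index_uniq ?size_tuple // sort_uniq enum_uniq.
Qed.

Lemma edge_pos_inj : injective edge_pos.
Proof.
by move=> f g /(congr1 fst) /= fg; rewrite -(tnth_bot_pos f) fg tnth_bot_pos.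
Qed.

Lemma perm_edges_insert : perm_edges (insert_edges s E) = edge_pos @: [set: T].
Proof.
apply/setP=> x; apply/imsetP/imsetP => [[p _ ->]|[f _ ->]].
  by exists (tnth (bot_list s E) p); rewrite // /edge_pos bot_pos_tnth permE.
by exists (bot_pos f); rewrite // /edge_pos permE tnth_bot_pos.
Qed.

Definition noncross (f g : T) : bool :=
  lex_lt (bot_loc f) (bot_loc g) && lex_lt (top_loc f) (top_loc g).

Lemma ltn_edge_pos f g :
  (bot_pos f < bot_pos g)%N && (top_pos f < top_pos g)%N = noncross f g.
Proof.
by rewrite /= !ltn_index_sort_lex ?mem_enum //; [exact: top_loc_inj|exact: bot_loc_inj].
Qed.

(** A product over all ordered pairs of edges can be cut along the sum type of old and new edges,
    unlike the cardinal in the exponent. *)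
Lemma noncrossing_pairs_imset (X : {set T}) :
  (-1) ^+ noncrossing_pairs (edge_pos @: X)
    = \prod_f \prod_g (-1) ^+ [&& f \in X, g \in X & noncross f g] :> int.
Proof.
pose h (p : T * T) := (edge_pos p.1, edge_pos p.2).
have h_inj : injective h.
  by move=> [f g] [f' g'] /pair_equal_spec[/edge_pos_inj /= -> /edge_pos_inj /= ->].
rewrite /noncrossing_pairs.
have -> : [set p in setX (edge_pos @: X) (edge_pos @: X) |
    (p.1.1 < p.2.1)%N && (p.1.2 < p.2.2)%N]
   = h @: [set p : T * T | [&& p.1 \in X, p.2 \in X & noncross p.1 p.2]].
  apply/setP=> -[x y]; rewrite !inE /=; apply/idP/imsetP.
    case/andP=> /andP[/imsetP[f fX ->] /imsetP[g gX ->]].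
    by rewrite ltn_edge_pos => fg; exists (f, g); rewrite // inE /= fX gX.
  case=> -[f g]; rewrite inE /= => /and3P[fX gX fg] [-> ->].
  by rewrite !imset_f // ltn_edge_pos.
by rewrite card_imset // sign_card pair_bigA; apply: eq_bigr => p _; rewrite inE.
Qed.

Definition cell (i : 'I_(mp_size s)) : 'I_k.+1 * 'I_l.+1 :=
  (mp_bot s i, mp_top s (mp_perm s i)).

Lemma noncross_old (i j : 'I_(mp_size s)) :
  noncross (inl i) (inl j) = (i < j)%N && (mp_perm s i < mp_perm s j)%N.
Proof.
by rewrite /noncross /= !lex_lt_interval //; [exact: mp_top_mono|exact: mp_bot_mono].
Qed.

(** Slots of opposite parity never tie, so ranks do not matter. The old edge lies on one side of [e]
    at the bottom and on one side at the top; the pair is non-crossing exactly when these sides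
    agree, which is the condition in [Qmx]. *)
Lemma noncross_old_new (i : 'I_(mp_size s)) (e : E) :
  (-1) ^+ noncross (inl i) (inr e) * (-1) ^+ noncross (inr e) (inl i)
    = signF2 (Qmx e (cell i)) :> int.
Proof.
rewrite /Qmx signF2_nat -signr_addb; congr (_ ^+ nat_of_bool _).
rewrite /noncross /lex_lt /= /new_bot_loc /new_top_loc /=.
have dlt (m n : nat) : (m.*2.+1 < n.*2)%N = (m < n)%N.
  by rewrite -doubleS leq_double.
have dlt' (m n : nat) : (n.*2 < m.*2.+1)%N = (n <= m)%N by rewrite ltnS leq_double.
have dneq (m n : nat) : (m.*2.+1 == n.*2) = false.
  by apply/eqP => /(congr1 odd); rewrite /= !odd_double.
rewrite !dlt !dlt' ![_.*2 == _.*2.+1]eq_sym !dneq /= !orbF !ltnS !ltnNge.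
by do 2 case: leqP.
Qed.

Definition glue (Iu : {set 'I_(mp_size s)} * {ffun E -> 'F_2}) : {set T} :=
  [set f | match f with inl i => i \in Iu.1 | inr e => Iu.2 e == 1 end].

Definition unglue (X : {set T}) : {set 'I_(mp_size s)} * {ffun E -> 'F_2} :=
  ([set i | inl i \in X], [ffun e => (inr e \in X)%:R]).

Lemma glueK : cancel glue unglue.
Proof.
case=> I u; congr (_, _); first by apply/setP=> i; rewrite !inE.
by apply/ffunP=> e; rewrite ffunE inE /= -F2_natE.
Qed.

Lemma unglueK : cancel unglue glue.
Proof.
move=> X; apply/setP=> -[i|e]; rewrite !inE //= ffunE.
by case: (_ \in X).
Qed.

(** The vector $v_I$. *)
Definition parity (I : {set 'I_(mp_size s)}) : {ffun 'I_k.+1 * 'I_l.+1 -> 'F_2} :=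
  [ffun ij => \sum_(i in I) (cell i == ij)%:R].

Lemma sign_pairing (I : {set 'I_(mp_size s)}) (u : {ffun E -> 'F_2}) :
  signF2 (pairing u (parity I))
    = \prod_e \prod_i (if (i \in I) && (u e == 1) then signF2 (Qmx e (cell i)) else 1).
Proof.
rewrite /pairing (big_morph _ signF2D signF20); apply: eq_bigr => e _.
(* After exchanging the sums, each old edge contributes only at its own cell. *)
have -> : \sum_ij u e * Qmx e ij * parity I ij = \sum_(i in I) u e * Qmx e (cell i).
  under eq_bigr => ij _ do rewrite ffunE mulr_sumr.
  rewrite exchange_big; apply: eq_bigr => i _ /=.
  rewrite (bigD1 (cell i)) //= eqxx mulr1 big1 ?addr0 // => ij.
  by rewrite eq_sym => /negbTE->; rewrite mulr0.
rewrite (big_morph _ signF2D signF20) big_mkcond; apply: eq_bigr => i _ /=.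
by case: (i \in I) => //=; rewrite [u e]F2_natE; case: (u e == 1); rewrite ?eqxx ?mul1r.
Qed.

(** The product has four blocks. The old-old and new-new blocks give the two internal signs; the two
    mixed blocks merge, pair by pair, through [noncross_old_new] into the sign of the pairing. *)
Lemma sign_glue (I : {set 'I_(mp_size s)}) (u : {ffun E -> 'F_2}) :
  \prod_f \prod_g (-1) ^+ [&& f \in glue (I, u), g \in glue (I, u) & noncross f g]
    = (\prod_i \prod_j
         (-1) ^+ [&& i \in I, j \in I & (i < j)%N && (mp_perm s i < mp_perm s j)%N])
      * ((-1) ^+ new_noncrossing_pairs u * signF2 (pairing u (parity I))) :> int.
Proof.
rewrite big_sumType /=.
under eq_bigr => i _ do rewrite big_sumType /=.
under [X in _ * X]eq_bigr => e _ do rewrite big_sumType /=.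
rewrite !big_split /= -!mulrA; congr (_ * _).
  by apply: eq_bigr => i _; apply: eq_bigr => j _; rewrite !inE noncross_old.
rewrite mulrA mulrC; congr (_ * _).
  rewrite /new_noncrossing_pairs sign_card pair_bigA.
  by apply: eq_bigr => p _; rewrite !inE.
rewrite sign_pairing exchange_big -big_split /=; apply: eq_bigr => e _.
rewrite -big_split /=; apply: eq_bigr => i _.
rewrite !inE /= -noncross_old_new.
by case: (i \in I); case: (u e == 1) => //=; rewrite mulrC.
Qed.

Definition edge_sign (b : bool) (I : {set 'I_(mp_size s)}) : int :=
  (-1) ^+ (b * #|I|)
  * \prod_i \prod_j
      (-1) ^+ [&& i \in I, j \in I & (i < j)%N && (mp_perm s i < mp_perm s j)%N].

Lemma edge_sign_neq0 b I : edge_sign b I != 0.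
Proof.
rewrite mulf_neq0 ?signr_eq0 //.
by do 2 (apply/prodf_neq0 => ? _); rewrite signr_eq0.
Qed.

Lemma card_glue I u : #|glue (I, u)| = (#|I| + weight u)%N.
Proof.
rewrite /weight -!sum1_card big_mkcond big_sumType /=; congr (_ + _)%N.
  by rewrite [RHS]big_mkcond; apply: eq_bigr => i _; rewrite inE.
by rewrite [RHS]big_mkcond; apply: eq_bigr => e _; rewrite !inE.
Qed.

Lemma signed_A_perm_insert b :
  signed_A_perm b (insert_edges s E)
    = \sum_I edge_sign b I * signed_A_marked b E (parity I).
Proof.
(* Sets of edges of the diagram are the images under [edge_pos] of the subsets of [T]; [glue] then
   splits such a subset into its old and new parts. *)
rewrite /signed_A_perm (reindex_onto (fun X : {set T} => edge_pos @: X)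
                              (fun I => edge_pos @^-1: I)) /=; last first.
  move=> I; rewrite perm_edges_insert => sI; apply/setP=> x; apply/imsetP/idP.
    by case=> f; rewrite inE => fI ->.
  by move=> xI; have /imsetP[f _ xf] := subsetP sI x xI; exists f; rewrite // inE -xf.
rewrite (eq_bigl xpredT) => [|X]; last first.
  rewrite perm_edges_insert imsetS ?subsetT //=.
  by apply/eqP/setP=> f; rewrite inE mem_imset //; exact: edge_pos_inj.
rewrite (reindex glue) /=; last by exists unglue => X _; [exact: glueK|exact: unglueK].
rewrite -(pair_bigA _ (fun I u => (-1) ^+ (b * #|edge_pos @: glue (I, u)|
                              + noncrossing_pairs (edge_pos @: glue (I, u))))) /=.
apply: eq_bigr => I _; rewrite mulr_sumr; apply: eq_bigr => u _.
rewrite exprD noncrossing_pairs_imset sign_glue card_imset; last exact: edge_pos_inj.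
rewrite card_glue mulnDr !exprD -/(signF2 _) /edge_sign.
by rewrite -!mulrA; congr (_ * _); rewrite mulrCA.
Qed.

End Expansion.

(** * Marked permutations with a prescribed set of cells *)

Lemma leq_tnth_sorted {T : Type} (f : T -> nat) {n} (t : n.-tuple T) (i j : 'I_n) :
  sorted (relpre f leq) t -> (i <= j)%N -> (f (tnth t i) <= f (tnth t j))%N.
Proof.
move=> t_sorted ij; have x0 := tnth t i; rewrite !(tnth_nth x0).
have tr : transitive (relpre f leq) by move=> y x z; exact: leq_trans.
by apply: (sorted_leq_nth tr _ _ t_sorted) => //;
   rewrite ?inE ?size_tuple // => x; exact: leqnn.
Qed.

(** List [S] along the bottom by first coordinate and along the top by second coordinate, and join
    the two occurrences of each cell. Ties may be broken in any way, since the interval maps need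
    only be nondecreasing. *)
Lemma exists_marked_perm {k l} (S : {set 'I_k.+1 * 'I_l.+1}) :
  exists2 s : marked_perm k l, injective (cell s) & codom (cell s) =i S.
Proof.
pose n := #|S|.
have sort_size r : size (sort r (enum S)) == n by rewrite size_sort -cardE.
pose bs := Tuple (sort_size (relpre (fun ij => nat_of_ord ij.1) leq)).
pose ts := Tuple (sort_size (relpre (fun ij => nat_of_ord ij.2) leq)).
have bs_inj : injective (tnth bs) by apply/tuple_uniqP; rewrite sort_uniq enum_uniq.
have bs_mem ij : (ij \in bs) = (ij \in S) by rewrite mem_sort mem_enum.
have ts_mem ij : (ij \in ts) = (ij \in S) by rewrite mem_sort mem_enum.
have pos_proof (p : 'I_n) : (index (tnth bs p) ts < n)%N.
  have := index_mem (tnth bs p) ts; rewrite size_tuple => ->.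
  by rewrite ts_mem -bs_mem mem_tnth.
pose pos p := Ordinal (pos_proof p).
have tnth_pos p : tnth ts (pos p) = tnth bs p.
  by rewrite (tnth_nth (tnth bs p)) nth_index // ts_mem -bs_mem mem_tnth.
have pos_inj : injective pos.
  by move=> p q pq; apply: bs_inj; rewrite -!tnth_pos pq.
have bs_mono (i j : 'I_n) : (i <= j)%N -> ((tnth bs i).1 <= (tnth bs j).1)%N.
  apply: (leq_tnth_sorted (fun ij => nat_of_ord ij.1)).
  by apply: sort_sorted => x y; exact: leq_total.
have ts_mono (i j : 'I_n) : (i <= j)%N -> ((tnth ts i).2 <= (tnth ts j).2)%N.
  apply: (leq_tnth_sorted (fun ij => nat_of_ord ij.2)).
  by apply: sort_sorted => x y; exact: leq_total.
pose s := @MarkedPerm k l n (perm pos_inj) _ _ bs_mono ts_mono.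
have cellE i : cell s i = tnth bs i.
  by rewrite /cell /= permE tnth_pos -surjective_pairing.
exists s => [i j|ij]; first by rewrite !cellE => /bs_inj.
by rewrite -bs_mem; apply/codomP/tnthP => -[i ->]; exists i; rewrite ?cellE.
Qed.

(** A cell of odd parity contains an edge of [I], so the support lies in the image of [I] under
    [cell]. *)
Lemma card_supp_parity {k l} (s : marked_perm k l) (I : {set 'I_(mp_size s)}) :
  (#|[set ij | parity s I ij == 1%R]| <= #|I|)%N.
Proof.
apply: leq_trans (leq_imset_card (cell s) I); apply/subset_leq_card/subsetP => ij.
rewrite inE ffunE; apply: contraTT => nij; rewrite big1 // => i iI.
by case: eqP => // ijE; rewrite -ijE imset_f in nij.
Qed.

Lemma parity_setT {k l} {s : marked_perm k l} {v : {ffun 'I_k.+1 * 'I_l.+1 -> 'F_2}} :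
    injective (cell s) -> codom (cell s) =i [set ij | v ij == 1] ->
  parity s [set: _] = v.
Proof.
move=> s_inj s_codom; apply/ffunP=> ij; rewrite ffunE [v ij]F2_natE.
move: (s_codom ij); rewrite inE => <-.
case: (boolP (ij \in _)) => [/codomP[i ->]|nij].
  rewrite (bigD1 i) ?inE //= eqxx big1 ?addr0 // => j /andP[_ /negbTE].
  by rewrite (inj_eq s_inj) => ->.
rewrite big1 // => i _; case: eqP => // ijE.
by rewrite -ijE codom_f in nij.
Qed.

(** * The equivalence, for both signs at once *)

Section Equivalence.
Context {R : realType} {k l N : nat} (K : 'I_N -> R) (E : 'I_N -> edge_set k l).
Variable b : bool.

Lemma sum_signed_A_perm (s : marked_perm k l) :
  \sum_(i < N) K i * (signed_A_perm b (insert_edges s (E i)))%:~R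
    = \sum_I (edge_sign s b I)%:~R
        * \sum_(i < N) K i * (signed_A_marked b (E i) (parity s I))%:~R.
Proof.
under eq_bigr => i _ do rewrite signed_A_perm_insert rmorph_sum mulr_sumr.
rewrite exchange_big; apply: eq_bigr => I _; rewrite mulr_sumr.
by apply: eq_bigr => i _; rewrite rmorphM mulrCA.
Qed.

Lemma signed_equivalence :
  (forall v : {ffun 'I_k.+1 * 'I_l.+1 -> 'F_2},
      \sum_(i < N) K i * (signed_A_marked b (E i) v)%:~R = 0)
   <->
   (forall s : marked_perm k l,
      \sum_(i < N) K i * (signed_A_perm b (insert_edges s (E i)))%:~R = 0).
Proof.
split=> [Ev s|Es v].
  by rewrite sum_signed_A_perm big1 // => I _; rewrite Ev mulr0.
have [n] := ubnP #|[set ij | v ij == 1]|; elim: n v => // n IHn v ltn.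
have [s s_inj s_codom] := exists_marked_perm [set ij | v ij == 1].
have size_s : mp_size s = #|[set ij | v ij == 1]|.
  by rewrite -(eq_card s_codom) card_codom // card_ord.
(* The full set contributes the sum at [v] times a nonzero sign; all other terms vanish by
   induction. *)
have := Es s; rewrite sum_signed_A_perm (bigD1 [set: _]) //= [X in _ + X]big1 => [|I IT].
  rewrite addr0 (parity_setT s_inj s_codom) => /eqP; rewrite mulf_eq0 intr_eq0.
  by rewrite (negbTE (edge_sign_neq0 _ _ _)) => /eqP.
(* A proper subset has fewer than [mp_size s] edges, and [mp_size s] is the size of the support of
   [v]. *)
rewrite IHn ?mulr0 //; apply: leq_ltn_trans (card_supp_parity _ _) _.
rewrite -ltnS (leq_trans _ ltn) // ltnS -size_s -[X in (_ < X)%N]card_ord -cardsT.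
by rewrite proper_card // properT.
Qed.

End Equivalence.

Theorem mainTheorem4 (R : realType) (k l N : nat) (hN : (1 <= N)%N)
    (K : 'I_N -> R) (E : 'I_N -> edge_set k l) :
  ((forall v : {ffun 'I_k.+1 * 'I_l.+1 -> 'F_2},
      \sum_(i < N) K i * (A_marked (E i) v)%:~R = 0)
   <->
   (forall s : marked_perm k l,
      \sum_(i < N) K i * (A_perm (insert_edges s (E i)))%:~R = 0))
  /\
  ((forall v : {ffun 'I_k.+1 * 'I_l.+1 -> 'F_2},
      \sum_(i < N) K i * (Abar_marked (E i) v)%:~R = 0)
   <->
   (forall s : marked_perm k l,
      \sum_(i < N) K i * (Abar_perm (insert_edges s (E i)))%:~R = 0)).
Proof.
(* With [false] the extra exponent computes to 0, so conversion suffices; with [true] the factor 1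
   must be rewritten away. *)
split; first exact: (signed_equivalence K E false).
have AbarE m (t : 'S_m) : Abar_perm t = signed_A_perm true t.
  by apply: eq_bigr => I _; rewrite mul1n.
have markedE F v : @Abar_marked k l F v = signed_A_marked true F v.
  by apply: eq_bigr => u _; rewrite mul1n.
have [H1 H2] := signed_equivalence K E true.
split=> H x.
  by under eq_bigr => i _ do rewrite AbarE; apply: H1 => v;
     under eq_bigr => i _ do rewrite -markedE.
by under eq_bigr => i _ do rewrite markedE; apply: H2 => s;
   under eq_bigr => i _ do rewrite -AbarE.
Qed.
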